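(* Let $k\in\{0,1,\dots,m-1\}$ and suppose the observation errors are uncorrelated, i.e. $\mathbf R_{k+1}$ (and hence $\mathbf R_k$) is diagonal. Then the (positive) eigenvalues of $\mathcal A_1$ move away from zero or are unchanged when the new observation is added: writing $\lambda_j(\cdot)$ for the $j$-th largest eigenvalue, $$\lambda_j(\mathcal A_{1,k})\le\lambda_j(\mathcal A_{1,k+1})\qquad\text{for all } j\in\{1,\dots,m\}.$$
   Context: Let $N,n\ge 1$ be integers and $m=(N+1)n$. Let $B,Q_1,\dots,Q_N\in\mathbb R^{n\times n}$ be symmetric positive definite and $M_0,\dots,M_{N-1}\in\mathbb R^{n\times n}$ arbitrary. Let $\mathbf D=\mathrm{diag}(B,Q_1,\dots,Q_N)\in\mathbb R^{m\times m}$ (block diagonal), and let $\mathbf L\in\mathbb R^{m\times m}$ be the block lower bidiagonal matrix with $n\times n$ identity blocks on the diagonal and blocks $-M_0,\dots,-M_{N-1}$ on the first block subdiagonal (all other blocks zero). A system with $k$ observations is described by a symmetric positive definite matrix $\mathbf R_k\in\mathbb R^{k\times k}$ and a matrix $\mathbf H_k\in\mathbb R^{k\times m}$ (both empty for $k=0$, with $\mathbf H_0^T\mathbf R_0^{-1}\mathbf H_0=\mathbf 0$). Adding one observation means passing to $$\mathbf R_{k+1}=\begin{pmatrix}\mathbf R_k& r\\ r^T&\alpha\end{pmatrix},\qquad \mathbf H_{k+1}=\begin{pmatrix}\mathbf H_k\\ h_{k+1}^T\end{pmatrix},$$ with $r\in\mathbb R^k$, $\alpha>0$, $h_{k+1}\in\mathbb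 R^m$ and $\mathbf R_{k+1}$ symmetric positive definite; $\mathbf D$ and $\mathbf L$ are unchanged. Define the symmetric positive definite matrix $$\mathcal A_{1,k}=\mathbf L^T\mathbf D^{-1}\mathbf L+\mathbf H_k^T\mathbf R_k^{-1}\mathbf H_k\in\mathbb R^{m\times m}.$$ *)

(* Defs.v *)
From mathcomp Require Import all_boot all_order all_algebra.
From mathcomp Require Import sesquilinear polyrcf reals.

Set Implicit Arguments.
Unset Strict Implicit.
Unset Printing Implicit Defensive.

Import Order.TTheory GRing.Theory Num.Theory.
Local Open Scope ring_scope.

Definition posdefmx (R : realType) (p : nat) (A : 'M[R]_p) : Prop :=
  A \is symmetricmx /\
  forall x : 'cV[R]_p, x != 0 -> 0 < (x^T *m A *m x) 0 0.

(* All real eigenvalues of [A], repeated according to their multiplicity as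
   roots of the characteristic polynomial, in nonincreasing order.  For a
   symmetric [A] the characteristic polynomial splits over [R], so the
   sequence has length [p]. *)
Definition eigenvals (R : realType) (p : nat) (A : 'M[R]_p) : seq R :=
  let chi := char_poly A in
  sort >=%R (flatten [seq nseq (mup x chi) x | x <- rootsR chi]).

(* The [j]-th largest eigenvalue, counting from 1. *)
Definition eigenval (R : realType) (p : nat) (A : 'M[R]_p) (j : nat) : R :=
  (eigenvals A)`_j.-1.

Lemma eigenvals_split (R : realType) (p : nat) (A : 'M[R]_p) (s : seq R) :
  char_poly A = \prod_(x <- s) ('X - x%:P) -> eigenvals A = sort >=%R s.
Proof.
move=> chiE; have chi_n0 : char_poly A != 0.
  by rewrite monic_neq0 ?char_poly_monic.
have rE x : (x \in rootsR (char_poly A)) = (x \in s).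
  have := roots_on_rootsR chi_n0 x.
  by rewrite in_itv /= => <-; rewrite {1}chiE root_prod_XsubC.
apply/perm_sortP; [exact: ge_total|exact: ge_trans|exact: ge_anti|].
apply/allP => x _ /=; rewrite count_flatten -!map_comp sumnE !big_map /=.
have [xs|xs] := boolP (x \in s); last first.
  rewrite (count_memPn xs) big1_seq // => y /= ys; rewrite count_nseq /=.
  by case: eqP => [yx|//]; move: ys xs; rewrite rE yx => ->.
have ux : uniq (rootsR (char_poly A)) by apply: uniq_roots.
rewrite (bigD1_seq x) ?rE //= count_nseq /= eqxx mul1n chiE mu_prod_XsubC.
by rewrite big1 ?addn0 // => y /negPf yx; rewrite count_nseq /= yx.
Qed.

(* The order (N + 1) n, in the form given to block matrices by [\mxblock]. *)
Definition bdim (N n : nat) : nat := (\sum_(i < N.+1) n)%N.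

Lemma bdimE (N n : nat) : bdim N n = (N.+1 * n)%N.
Proof. by rewrite /bdim sum_nat_const card_ord. Qed.

(* [Q i] is the matrix written Q_{i+1}; it sits in block (i+1, i+1). *)
Definition covmx (R : realType) (N n : nat) (B : 'M[R]_n)
    (Q : 'I_N -> 'M[R]_n) : 'M[R]_(bdim N n) :=
  \mxdiag_(i < N.+1) (if unlift ord0 i is Some i' then Q i' else B).

(* Blocks are numbered from 0: block (i'+1, i') is - M_{i'}. *)
Definition modelmx (R : realType) (N n : nat) (M : 'I_N -> 'M[R]_n) :
    'M[R]_(bdim N n) :=
  \mxblock_(i < N.+1, j < N.+1)
    (if i == j then 1%:M
     else if unlift ord0 i is Some i' then
       if i' == j :> nat then - M i' else 0
     else 0 : 'M[R]_n).

(* For k = 0 the product with empty matrices is 0. *)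
Definition A1mx (R : realType) (m k : nat) (D L : 'M[R]_m)
    (Rk : 'M[R]_k) (H : 'M[R]_(k, m)) : 'M[R]_m :=
  L^T *m invmx D *m L + H^T *m invmx Rk *m H.

Definition obscov_step (R : realType) (k : nat) (Rk : 'M[R]_k)
    (r : 'cV[R]_k) (alpha : R) : 'M[R]_(k + 1) :=
  block_mx Rk r r^T alpha%:M.

Definition obsop_step (R : realType) (m k : nat) (H : 'M[R]_(k, m))
    (h : 'cV[R]_m) : 'M[R]_(k + 1, m) :=
  col_mx H h^T.

(* Main.v *)
(* With uncorrelated errors r = 0, so the new observation adds the positive
   semidefinite rank-one term alpha^-1 h h^T to A_1, and Weyl's monotonicity
   theorem applies: for symmetric A <= B and every c, B has at least as many
   eigenvalues >= c as A (Courant-Fischer dimension count), hence the sorted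
   eigenvalues compare entrywise.
   Real symmetric matrices are diagonalized by unitary matrices over R[i], so
   the forms A <= B are first extended to Hermitian forms. *)
Require Import Defs.
From mathcomp Require Import all_boot all_order all_algebra.
From mathcomp Require Import reals.
From mathcomp Require Import sesquilinear spectral polyrcf complex.

Set Implicit Arguments.
Unset Strict Implicit.
Unset Printing Implicit Defensive.

Import Order.TTheory GRing.Theory Num.Theory.
Local Open Scope ring_scope.

(** * Characteristic polynomials and comparison of sorted sequences *)

Lemma symmetricmxP (F : fieldType) p (A : 'M[F]_p) :
  reflect (A^T = A) (A \is symmetricmx).
Proof.
by apply: (iffP (is_hermitianmxP _ _ _)); rewrite expr0 scale1r map_mx_id.
Qed.

Lemma char_poly_conj (F : fieldType) p (P A : 'M[F]_p) :
  P \in unitmx -> char_poly (invmx P *m A *m P) = char_poly A.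
Proof.
move=> Pu; have PK : map_mx polyC (invmx P) *m map_mx polyC P = 1%:M.
  by rewrite -map_mxM mulVmx // map_mx1.
(* The scalar matrix ['X] commutes with [P], so conjugation passes through the characteristic
   matrix. *)
have -> : char_poly (invmx P *m A *m P) =
    \det (map_mx polyC (invmx P) *m char_poly_mx A *m map_mx polyC P).
  rewrite /char_poly /char_poly_mx mulmxBr mulmxBl scalar_mxC.
  by rewrite -[_ *m _ *m map_mx _ P]mulmxA PK mulmx1 !map_mxM.
by rewrite !det_mulmx mulrAC -det_mulmx PK det1 mul1r.
Qed.

(** Take [c] to be the entry of [s] at index [j]: the first [j + 1] entries of [s] are at least [c].
    Were the entry of [t] at [j] below [c], at most [j] entries of [t] could reach [c], against the
    count hypothesis. *)
Lemma nth_le_count (R : realDomainType) (s t : seq R) j :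
  sorted >=%R s -> sorted >=%R t -> (j < size s)%N ->
  (forall c, (count [pred x | (c <= x)%R] s <=
              count [pred x | (c <= x)%R] t)%N) ->
  s`_j <= t`_j.
Proof.
move=> ss st js le_st; rewrite leNgt; apply/negP; move: le_st => /(_ s`_j).
have: all [pred x | s`_j <= x] (take j.+1 s).
  apply/(all_nthP 0) => i; rewrite size_takel // => ij; rewrite nth_take //=.
  by apply: (sorted_leq_nth ge_trans ge_refl 0 ss) => //; rewrite inE (leq_trans ij).
have: t`_j < s`_j -> ~~ has [pred x | s`_j <= x] (drop j t).
  move=> lt_ts; rewrite -all_predC; apply/(all_nthP 0) => i.
  rewrite size_drop nth_drop ltn_subRL /= -ltNge => it.
  apply: le_lt_trans lt_ts; apply: (sorted_leq_nth ge_trans ge_refl 0 st) => //.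
  - by rewrite inE (leq_ltn_trans _ it) // leq_addr.
  - by rewrite leq_addr.
move: (s`_j) => c t0 s1 le_st /t0; rewrite has_count -leqNgt leqn0 => /eqP t1.
suff : (j < j)%N by rewrite ltnn.
apply: (@leq_trans (count [pred x | c <= x] s)).
  move: s1; rewrite all_count size_takel // => /eqP {1}<-.
  by rewrite -[in leqRHS](cat_take_drop j.+1 s) count_cat leq_addr.
rewrite (leq_trans le_st) // -[t](cat_take_drop j) count_cat t1 addn0.
by rewrite (leq_trans (count_size _ _)) // size_take; case: ltnP.
Qed.

(** * Spectral decomposition and Weyl monotonicity through [R[i]] *)

Local Open Scope complex_scope.
Local Open Scope sesquilinear_scope.

(** The complexification is Hermitian, so its spectrum is real and the diagonal comes from a vector
    [a] over [R]; eigenvalues can then be compared in the total order of [R]. *)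
Lemma real_spectral (R : realType) p (A : 'M[R]_p) : A \is symmetricmx ->
  exists2 P : 'M[R[i]]_p, P \is unitarymx & exists a : 'rV[R]_p,
    map_mx (real_complex R) A =
      invmx P *m diag_mx (map_mx (real_complex R) a) *m P.
Proof.
move=> /symmetricmxP As; set AC := map_mx _ A.
have AH : AC \is hermsymmx.
  apply/is_hermitianmxP; rewrite expr0 scale1r; apply/matrixP => i j.
  by rewrite !mxE -{1}As mxE; apply: esym; exact: conjc_real.
exists (spectralmx AC); first exact: spectral_unitarymx.
exists (map_mx (@complex.Re R) (spectral_diag AC)).
rewrite [LHS](orthomx_spectralP (hermitian_normalmx AH)).
congr (_ *m diag_mx _ *m _); apply/rowP => i; rewrite !mxE RRe_real //.
exact: (mxOverP (hermitian_spectral_diag_real AH)).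
Qed.

(** The characteristic polynomial splits over [R[i]] with the real roots [a 0 i]; the factorization
    descends to [R] because the embedding is injective on polynomials. *)
Lemma eigenvals_spectral (R : realType) p (A : 'M[R]_p) (P : 'M[R[i]]_p)
    (a : 'rV[R]_p) : P \in unitmx ->
  map_mx (real_complex R) A =
    invmx P *m diag_mx (map_mx (real_complex R) a) *m P ->
  eigenvals A = sort >=%R [seq a 0 i | i : 'I_p].
Proof.
move=> Pu AE; apply: eigenvals_split.
apply: (map_poly_inj (real_complex R)).
rewrite map_char_poly AE char_poly_conj // char_poly_trig ?diag_mx_is_trig //.
rewrite rmorph_prod /= big_image /=; apply: eq_bigr => i _.
by rewrite rmorphB /= map_polyX map_polyC /= !mxE eqxx mulr1n.
Qed.

(** Keeps the index of [eigenval] in range, so that the default value 0 is never read for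
    [1 <= j <= p]. *)
Lemma size_eigenvals (R : realType) p (A : 'M[R]_p) :
  A \is symmetricmx -> size (eigenvals A) = p.
Proof.
move=> /real_spectral[P /unitarymx_unit Pu [a AE]].
by rewrite (eigenvals_spectral Pu AE) size_sort size_map -cardE card_ord.
Qed.

(** Write [x = u + 'i v] with [u], [v] real. Symmetry of [E] cancels the cross terms, leaving the
    sum of the real forms at [u] and [v]. *)
Lemma psd_complexify (R : realType) p (E : 'M[R]_p) (x : 'rV[R[i]]_p) :
  E \is symmetricmx -> (forall y : 'cV[R]_p, 0 <= (y^T *m E *m y) 0 0) ->
  0 <= (x *m map_mx (real_complex R) E *m x^t*) 0 0.
Proof.
move=> /symmetricmxP Es E0.
pose u := map_mx (@complex.Re R) x; pose v := map_mx (@complex.Im R) x.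
have xE : x = map_mx (real_complex R) u + 'i *: map_mx (real_complex R) v.
  by apply/rowP => i; rewrite !mxE; exact: complexE.
have xcE : x^t* = map_mx (real_complex R) u^T - 'i *: map_mx (real_complex R) v^T.
  apply/colP => i; rewrite !mxE; case: (x 0 i) => b c.
  by rewrite -mulrN -rmorphN; exact: (complexE (b -i* c)).
rewrite xcE {1}xE mulmxDl mulmxDl 2!mulmxDr !mulmxN -!scalemxAl -!scalemxAr.
rewrite -!map_mxM scalerA -[_ * _]/(_ ^+ 2) sqr_i.
have -> : u *m E *m v^T = v *m E *m u^T.
  apply/matrixP => i j; rewrite !ord1.
  transitivity ((v *m E *m u^T)^T 0 0); last by rewrite mxE.
  by rewrite !trmx_mul trmxK Es mulmxA.
rewrite addrA subrK scaleN1r opprK -map_mxD mxE ler0c mxE.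
by rewrite addr_ge0 // -[X in X *m E *m _]trmxK.
Qed.

Lemma exists_row_ann (F : fieldType) p q (K : 'M[F]_(p, q)) : (q < p)%N ->
  exists2 x : 'rV[F]_p, x != 0 & x *m K = 0.
Proof.
move=> qp; have : kermx K != 0.
  by rewrite kermx_eq0 /row_free neq_ltn (leq_ltn_trans (rank_leq_col K)).
by move=> /rowV0Pn[x /sub_kermxP xK x0]; exists x.
Qed.

Lemma unitary_quad (C : numClosedFieldType) p (P : 'M[C]_p) (a x : 'rV[C]_p) :
  P \is unitarymx ->
  (x *m (invmx P *m diag_mx a *m P) *m x^t*) 0 0 =
  \sum_i a 0 i * `|(x *m invmx P) 0 i| ^+ 2.
Proof.
move=> PU; set w := x *m invmx P.
have Px : P *m x^t* = w^t* by rewrite trmx_mul map_mxM invmx_unitary // trmxCK.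
rewrite !mulmxA -[_ *m x^t*]mulmxA Px mxE; apply: eq_bigr => i _.
by rewrite mul_mx_diag !mxE normCK mulrAC mulrC.
Qed.

Lemma count_eigenvals_le (R : realType) p (A B : 'M[R]_p) c :
  A \is symmetricmx -> B \is symmetricmx ->
  (forall y : 'cV[R]_p, (y^T *m A *m y) 0 0 <= (y^T *m B *m y) 0 0) ->
  (count [pred x | (c <= x)%R] (eigenvals A) <=
   count [pred x | (c <= x)%R] (eigenvals B))%N.
Proof.
move=> As Bs AB.
(* If [#{i | c <= b_i} < #{i | c <= a_i}], some [x != 0] lies both in the span
   of the eigenvectors of [A] with [a_i >= c] and in that of the eigenvectors
   of [B] with [b_i < c]; there [x B x^* < c x x^* <= x A x^*]. *)
have [P PU [a AE]] := real_spectral As; have Pu := unitarymx_unit PU.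
have [S SU [b BE]] := real_spectral Bs; have Su := unitarymx_unit SU.
rewrite (eigenvals_spectral Pu AE) (eigenvals_spectral Su BE) !count_sort.
have cE (d : 'rV[R]_p) : count [pred x | (c <= x)%R] [seq d 0 i | i : 'I_p] =
    #|[pred i | c <= d 0 i]|.
  by rewrite count_map -size_filter cardE /enum_mem filter_predT.
rewrite !cE leqNgt; apply/negP => lt_BA.
(* [x *m K = 0] makes the coordinates of [x] vanish where [a_i < c] in the eigenbasis of [A] and
   where [c <= b_i] in that of [B]. By [lt_BA], [K] has fewer than [p] columns. *)
pose K := row_mx
  (colsub (fun i : 'I_#|[pred i | ~~ (c <= a 0 i)]| => enum_val i) (invmx P))
  (colsub (fun i : 'I_#|[pred i | c <= b 0 i]| => enum_val i) (invmx S)).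
have [|x x0 xK] := exists_row_ann K.
  by rewrite -[X in (_ < X)%N]card_ord -(cardC [pred i | c <= a 0 i]) addnC ltn_add2r.
move: xK; rewrite mul_mx_row -row_mx0 => /eq_row_mx[xP xS].
have xP0 i : ~~ (c <= a 0 i) -> (x *m invmx P) 0 i = 0.
  move=> ia; have ia' : i \in [pred i | ~~ (c <= a 0 i)] by [].
  move/rowP: xP => /(_ (enum_rank_in ia' i)).
  by rewrite mulmx_colsub mxE enum_rankK_in // => ->; rewrite mxE.
have xS0 i : c <= b 0 i -> (x *m invmx S) 0 i = 0.
  move=> ia; have ia' : i \in [pred i | c <= b 0 i] by [].
  move/rowP: xS => /(_ (enum_rank_in ia' i)).
  by rewrite mulmx_colsub mxE enum_rankK_in // => ->; rewrite mxE.
(* Parseval: the squared norm of [x] can be computed in either eigenbasis. *)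
have norm1 (T : 'M[R[i]]_p) : T \is unitarymx ->
    (x *m x^t*) 0 0 = \sum_i `|(x *m invmx T) 0 i| ^+ 2.
  move=> TU; rewrite -[X in X *m _]mulmx1 -(mulVmx (unitarymx_unit TU)).
  rewrite -[invmx T in X in X *m _]mulmx1 -diag_const_mx unitary_quad //.
  by apply: eq_bigr => i _; rewrite mxE mul1r.
have BAs : B - A \is symmetricmx.
  apply/symmetricmxP; move/symmetricmxP: As => {2}<-; move/symmetricmxP: Bs => {2}<-.
  by rewrite linearB.
have: 0 <= (x *m map_mx (real_complex R) (B - A) *m x^t*) 0 0.
  apply: psd_complexify => // y; rewrite mulmxBr mulmxBl.
  by rewrite [leRHS]mxE [X in _ + X]mxE subr_ge0.
rewrite map_mxB mulmxBr mulmxBl [leRHS]mxE [X in _ + X]mxE subr_ge0.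
(* The order of [R[i]] is partial; turning the negated [<=] into [<] requires both sums to be
   real. *)
rewrite AE BE !unitary_quad //; apply/negP; rewrite -real_ltNge; last 2 first.
- by rewrite rpred_sum // => i _; rewrite mxE realM ?realX ?normr_real ?complex_real.
- by rewrite rpred_sum // => i _; rewrite mxE realM ?realX ?normr_real ?complex_real.
apply: (@lt_le_trans _ _ (c%:C * (x *m x^t*) 0 0)).
  rewrite (norm1 S) // mulr_sumr.
  (* Strictness: some coordinate [k] of [x] in the eigenbasis of [B] is nonzero, which forces
     [b_k < c]. *)
  have : x *m invmx S != 0 by rewrite mulmx_free_eq0 // row_free_unit unitmx_inv.
  move/rV0Pn=> [k xk]; rewrite (bigD1 k) //= [ltRHS](bigD1 k) //= ltr_leD //.
    rewrite mxE ltr_pM2r ?exprn_gt0 ?normr_gt0 // ltcR ltNge.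
    by apply: contra xk => /xS0->.
  apply: ler_sum => i _; rewrite mxE.
  have [/xS0->|bc] := leP c (b 0 i); first by rewrite normr0 expr0n !mulr0.
  by rewrite ler_wpM2r ?exprn_ge0 // lecR ltW.
rewrite (norm1 P) // mulr_sumr; apply: ler_sum => i _; rewrite [map_mx _ _ _ _]mxE.
have [ca|/xP0->] := boolP (c <= a 0 i); last by rewrite normr0 expr0n !mulr0.
by rewrite ler_wpM2r ?exprn_ge0 // lecR.
Qed.

Lemma eigenval_le (R : realType) p (A B : 'M[R]_p) j :
  A \is symmetricmx -> B \is symmetricmx ->
  (forall y : 'cV[R]_p, (y^T *m A *m y) 0 0 <= (y^T *m B *m y) 0 0) ->
  (1 <= j <= p)%N -> eigenval A j <= eigenval B j.
Proof.
case: j => // j As Bs AB /= jp.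
apply: nth_le_count; rewrite ?size_eigenvals //; last 1 first.
- by move=> c; apply: count_eigenvals_le.
- by apply: sort_sorted; exact: ge_total.
- by apply: sort_sorted; exact: ge_total.
Qed.

(** * Positive definite matrices *)

Lemma eigenval_gt0 (R : realType) p (A : 'M[R]_p) j :
  posdefmx A -> (1 <= j <= p)%N -> 0 < eigenval A j.
Proof.
case: j => // j [As A0] /= jp.
have : eigenval A j.+1 \in eigenvals A by rewrite mem_nth ?size_eigenvals.
rewrite mem_sort => /flatten_mapP[x + /nseqP[-> _]].
rewrite -(roots_on_rootsR (monic_neq0 (char_poly_monic A))) => /andP[_].
rewrite -eigenvalue_root_char => /eigenvalueP[v vA v0].
(* At the left eigenvector [v] the form equals [x] times [v *m v^T]; it is positive while [v *m v^T]
   is nonnegative, so [x > 0]. *)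
have := A0 v^T; rewrite trmx_eq0 trmxK vA -scalemxAl mxE => /(_ v0).
have v2 : 0 <= (v *m v^T) 0 0.
  by rewrite mxE sumr_ge0 // => i _; rewrite mxE -expr2 sqr_ge0.
move=> xv; rewrite ltNge; apply: contraL xv => x0.
by rewrite -leNgt mulr_le0_ge0.
Qed.

Lemma posdefmx_unit (R : realType) p (A : 'M[R]_p) : posdefmx A -> A \in unitmx.
Proof.
move=> [_ A0]; rewrite -row_free_unit -kermx_eq0; apply/negPn/negP.
move=> /rowV0Pn[x /sub_kermxP xA x0].
by have := A0 x^T; rewrite trmx_eq0 trmxK xA mul0mx mxE ltxx => /(_ x0).
Qed.

Lemma posdefmx_congr (R : realType) p (L A : 'M[R]_p) :
  L \in unitmx -> posdefmx A -> posdefmx (L^T *m A *m L).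
Proof.
move=> Lu [/symmetricmxP As A0]; split.
  by apply/symmetricmxP; rewrite !trmx_mul trmxK As mulmxA.
move=> x x0; rewrite !mulmxA -trmx_mul -mulmxA; apply: A0.
by apply: contra x0 => /eqP Lx; rewrite -(mulKmx Lu x) Lx mulmx0.
Qed.

(** For symmetric [A], the inverse is the congruence of [A] by [invmx A]. *)
Lemma posdefmx_inv (R : realType) p (A : 'M[R]_p) :
  posdefmx A -> posdefmx (invmx A).
Proof.
move=> Apd; have Au := posdefmx_unit Apd; have /symmetricmxP As := Apd.1.
have := posdefmx_congr (L := invmx A) _ Apd.
by rewrite unitmx_inv trmx_inv As mulVmx // mul1mx; apply.
Qed.

Lemma posdefmx_mxdiag (R : realType) q (p_ : 'I_q -> nat)
    (A_ : forall i, 'M[R]_(p_ i)) :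
  (forall i, posdefmx (A_ i)) -> posdefmx (\mxdiag_i A_ i).
Proof.
move=> Apd; split.
  apply/symmetricmxP; rewrite tr_mxdiag; apply: eq_mxdiag => i.
  exact/symmetricmxP/(Apd i).1.
move=> x; rewrite -(submxcolK x) => x0.
(* The form splits into a sum over blocks; each term is nonnegative, and a nonzero block of [x]
   makes one of them positive. *)
rewrite tr_mxcol -mulmxA mul_mxdiag_mxcol mul_mxrow_mxcol summxE.
have A0 i : 0 <= ((submxcol x i)^T *m A_ i *m submxcol x i) 0 0.
  have [->|/(Apd i).2/ltW//] := eqVneq (submxcol x i) 0.
  by rewrite mulmx0 mxE.
have /existsP[k xk] : [exists k, submxcol x k != 0].
  apply: contraR x0; rewrite negb_exists => /forallP x0.
  apply/eqP; rewrite -[RHS]mxcol0; apply: eq_mxcol => i.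
  by have := x0 i; rewrite negbK => /eqP.
rewrite (bigD1 k) //= mulmxA ltr_wpDr ?(Apd k).2 //.
by apply: sumr_ge0 => i _; rewrite mulmxA.
Qed.

(** * The model and observation matrices *)

Lemma modelmx_unit (R : realType) N n (M : 'I_N -> 'M[R]_n) :
  modelmx M \in unitmx.
Proof.
(* The matrix is lower triangular with ones on the diagonal, so its determinant is 1. *)
rewrite unitmxE /modelmx det_trig.
  rewrite big1 ?unitr1 // => s _.
  by rewrite mxE eqxx mxE eqxx.
apply/is_trig_mxblockP; split=> [i j ij|i].
  rewrite -val_eqE ltn_eqF //.
  (* A block [- M i'] above the diagonal would need [i = i' + 1] and [j = i'], against [i < j]. *)
  case: unliftP => // i' ii'; case: eqP => // i'j.
  by move: ij; rewrite ii' -i'j /= ltnNge /= /bump /= leqnSn.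
by rewrite eqxx scalar_mx_is_trig.
Qed.

Lemma psd_congr (R : realType) p q (H : 'M[R]_(p, q)) (A : 'M[R]_p) (x : 'cV[R]_q) :
  posdefmx A -> 0 <= (x^T *m (H^T *m A *m H) *m x) 0 0.
Proof.
move=> [_ A0]; rewrite !mulmxA -trmx_mul -mulmxA.
by have [->|/A0/ltW//] := eqVneq (H *m x) 0; rewrite mulmx0 mxE.
Qed.

(** The model term is definite by congruence through the invertible [L]; the observation term is
    semidefinite. *)
Lemma posdefmx_A1mx (R : realType) m k (D L : 'M[R]_m) (Rk : 'M[R]_k)
    (H : 'M[R]_(k, m)) :
  posdefmx D -> L \in unitmx -> posdefmx Rk -> posdefmx (A1mx D L Rk H).
Proof.
move=> /posdefmx_inv Dpd Lu /posdefmx_inv Rpd.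
have [/symmetricmxP LDLs LDL0] := posdefmx_congr Lu Dpd; split.
  apply/symmetricmxP; rewrite linearD /= LDLs.
  by rewrite !trmx_mul trmxK (symmetricmxP _ Rpd.1) mulmxA.
move=> x /LDL0 x0; rewrite mulmxDr mulmxDl mxE ltr_wpDr //.
exact: psd_congr.
Qed.

Lemma A1mx_obs_step (R : realType) m k (D L : 'M[R]_m) (Rk : 'M[R]_k)
    (H : 'M[R]_(k, m)) (r : 'cV[R]_k) alpha (h : 'cV[R]_m) :
  Rk \in unitmx -> alpha != 0 -> is_diag_mx (obscov_step Rk r alpha) ->
  A1mx D L (obscov_step Rk r alpha) (obsop_step H h) =
  A1mx D L Rk H + alpha^-1 *: (h *m h^T).
Proof.
move=> Ru al0 dg; have r0 : r = 0.
  (* Entry [i] of [r] is entry [(i, k)] of the enlarged covariance, off the diagonal since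
     [i < k]. *)
  apply/colP => i; rewrite mxE.
  have /is_diag_mxP/(_ (lshift 1 i) (rshift k 0)) := dg.
  by rewrite block_mxEur; apply; rewrite /= neq_ltn addn0 ltn_ord.
(* With [r = 0] the inverse is block diagonal with blocks [invmx Rk] and [alpha^-1], so old and new
   observations contribute separately. *)
rewrite /A1mx /obscov_step /obsop_step r0 trmx0 invmx_block_diag; last first.
  by rewrite block_diag_mx_unit Ru unitmxE det_scalar1 unitfE.
rewrite invmx_scalar tr_col_mx trmxK mul_row_block !mulmx0 addr0 add0r.
by rewrite mul_row_col mul_mx_scalar -scalemxAl addrA.
Qed.

(** The increment of the form is [a] times the square of the scalar [h^T *m y]. *)
Lemma quad_add_outer (R : realType) m (A : 'M[R]_m) (h y : 'cV[R]_m) (a : R) :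
  0 <= a ->
  (y^T *m A *m y) 0 0 <= (y^T *m (A + a *: (h *m h^T)) *m y) 0 0.
Proof.
move=> a0; rewrite mulmxDr mulmxDl [leRHS]mxE lerDl -scalemxAr -scalemxAl mxE.
rewrite mulr_ge0 // mulmxA -[_ *m h^T *m y]mulmxA mxE big_ord1.
have -> : (y^T *m h) 0 0 = (h^T *m y) 0 0.
  transitivity ((h^T *m y)^T 0 0); last by rewrite mxE.
  by rewrite trmx_mul trmxK.
by rewrite -expr2 sqr_ge0.
Qed.

Unset Implicit Arguments.

Theorem theorem7 (R : realType) (N n : nat) (hN : (1 <= N)%N) (hn : (1 <= n)%N)
    (B : 'M[R]_n) (hB : posdefmx B)
    (Q : 'I_N -> 'M[R]_n) (hQ : forall i, posdefmx (Q i))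
    (M : 'I_N -> 'M[R]_n)
    (k : nat) (hk : (k < bdim N n)%N)
    (Rk : 'M[R]_k) (hRk : posdefmx Rk) (Hk : 'M[R]_(k, bdim N n))
    (r : 'cV[R]_k) (alpha : R) (halpha : 0 < alpha) (h : 'cV[R]_(bdim N n))
    (hRk1 : posdefmx (obscov_step Rk r alpha))
    (hdiag : is_diag_mx (obscov_step Rk r alpha)) :
  let D := covmx B Q in
  let L := modelmx M in
  let A1k := A1mx D L Rk Hk in
  let A1k1 := A1mx D L (obscov_step Rk r alpha) (obsop_step Hk h) in
  forall j : nat, (1 <= j <= bdim N n)%N ->
    0 < eigenval A1k j <= eigenval A1k1 j.
Proof.
move=> D L A1k A1k1 j hj.
have Dpd : posdefmx D.
  by apply: posdefmx_mxdiag => i; case: unliftP.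
have Lu : L \in unitmx by exact: modelmx_unit.
have A1kpd : posdefmx A1k by exact: posdefmx_A1mx.
have A1k1pd : posdefmx A1k1 by exact: posdefmx_A1mx.
rewrite eigenval_gt0 //=; apply: eigenval_le => //; [exact: A1kpd.1|exact: A1k1pd.1|].
move=> y; rewrite /A1k1 A1mx_obs_step ?posdefmx_unit ?gt_eqF //.
by rewrite quad_add_outer // invr_ge0 ltW.
Qed.
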